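(* Let $\Gamma$ be a connected regular graph on $v$ vertices that has an eigenvalue $\lambda$ with multiplicity $m$ and corresponding spectral idempotent $E_\lambda$. Let $\mathcal{E}=\langle J,E_\lambda\rangle^\circ$. Then $\mathcal{E}$ has dimension $2$ if and only if $\Gamma$ has a full indubitable partition corresponding to $\lambda$. Moreover, if $\dim\mathcal{E}=2$, then $E_\lambda=\frac{m+1}{v}K-\frac1v J$, where $K$ is permutation-similar to $I_{m+1}\otimes J_{v/(m+1)}$.
   Context: Graphs are finite, simple and undirected; eigenvalues of $\Gamma$ are those of its $01$-adjacency matrix $A$. The spectral idempotent $E_\lambda$ is the (real symmetric) matrix of the orthogonal projection onto $\ker(\lambda I-A)$. $J$ (or $J_n$) is the all-ones matrix, and $\circ$ is the entrywise (Hadamard) product. For a matrix $E$, $\langle J,E\rangle^\circ$ denotes the real vector space spanned by $J,E,E\circ E,E\circ E\circ E,\dots$. Two square matrices $A,B$ are permutation-similar if $B=P^\top AP$ for some permutation matrix $P$. A partition $\Pi$ of the vertex set of a connected graph $\Gamma$ (into nonempty cells) is indubitable with parameters $(a,b)$ if for each cell $\mathcal{P}\in\Pi$ and each vertex $x$ of $\Gamma$, the number of neighbors of $x$ in $\mathcal{P}$ equals $a$ if $x\in\mathcal{P}$, and equals $b$ otherwise. An indubitable partition with $r+1\ge 2$ cells corresponds to the number $\lambda=a-b$, which is then an eigenvalue of $\Gamma$; the partition is called full (corresponding to $\lambda$) if $r=m$, where $m$ is the multiplicity of $\lambda$ as an eigenvalue of $\Gamma$, i.e. if it has $m+1$ cells.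 *)

(* Defs.v *)
From HB Require Import structures.
From mathcomp Require Import all_boot all_order all_fingroup all_algebra.
From mathcomp Require Import reals.
From mathcomp Require Import mxtens.

Set Implicit Arguments.
Unset Strict Implicit.
Unset Printing Implicit Defensive.

Import GRing.Theory.
Local Open Scope ring_scope.

Section Graphs.
Variables (T : finType) (e : rel T).

Definition simple_graph : Prop := symmetric e /\ irreflexive e.

Definition connected_graph : Prop := forall x y : T, connect e x y.

Definition regular_graph : Prop :=
  exists k : nat, forall x : T, #|[set y | e x y]| = k.

Definition indubitable (Pi : {set {set T}}) (a b : nat) : Prop :=
  partition Pi [set: T] /\
  forall (C : {set T}) (x : T), C \in Pi ->
    #|[set y in C | e x y]| = (if x \in C then a else b).

(* Vertices are numbered by the enumeration of T. *)
Definition adjmx (R : realType) : 'M[R]_#|T| :=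
  \matrix_(i, j) (e (enum_val i) (enum_val j))%:R.

End Graphs.

Section Spectral.
Variables (R : realType) (n : nat).
Implicit Types (A : 'M[R]_n) (lambda : R).

Definition multiplicity A lambda : nat := \rank (eigenspace A lambda).

(* [eigenspace] and [proj_mx] act on row vectors: [eigenspace A lambda] is the
   row space {u | u *m A = lambda *: u}, and [kermx U^T] is the set of row
   vectors orthogonal to all rows of U.  For symmetric A this agrees with the
   column-vector convention, the projection matrix being symmetric. *)
Definition spectral_idempotent A lambda : 'M[R]_n :=
  let U := eigenspace A lambda in proj_mx U (kermx U^T).

End Spectral.

Definition full_indubitable (R : realType) (T : finType) (e : rel T)
    (lambda : R) (Pi : {set {set T}}) : Prop :=
  exists a b : nat,
    [/\ indubitable e Pi a b,
        (2 <= #|Pi|)%N,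
        lambda = a%:R - b%:R
      & #|Pi| = (multiplicity (adjmx e R) lambda).+1].

Section Hadamard.
Variables (R : realType) (n : nat).
Implicit Types (E M : 'M[R]_n).

Definition J_mx : 'M[R]_n := const_mx 1.

Definition hadamard (M1 M2 : 'M[R]_n) : 'M[R]_n := map2_mx *%R M1 M2.

Definition hadamard_pow E (k : nat) : 'M[R]_n := iter k (hadamard E) J_mx.

Definition hadamard_span E : 'M[R]_n -> Prop := fun M =>
  exists (d : nat) (c : 'I_d -> R), M = \sum_(k < d) c k *: hadamard_pow E k.

Definition perm_similar (A B : 'M[R]_n) : Prop :=
  exists P : 'M[R]_n, is_perm_mx P /\ B = P^T *m A *m P.

End Hadamard.

Arguments J_mx : clear implicits.

(* A linear subspace given as a predicate on V has dimension d. *)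
Definition has_dim (R : realType) (V : vectType R) (S : V -> Prop) (d : nat) :
    Prop :=
  exists U : {vspace V}, (forall x : V, x \in U <-> S x) /\ \dim U = d.

(* Main.v *)
(** Entries of a matrix spanning with [J] a 2-dimensional Hadamard algebra take
    exactly two values.  If [lambda] were the valency, connectedness would make
    [E] constant; hence [E J = 0], the two values have opposite signs [q < 0 < p]
    and every diagonal entry is [p].  Rows of the symmetric idempotent [E] have
    Gram matrix [E], so "[E x y = p]" means that rows [x] and [y] are equal: it is
    an equivalence relation with matrix [K], and [E = q J + (p - q) K].  Zero row
    sums give classes of one size [s], idempotency gives [E = K / s - J / v], the
    trace gives [v / s = m + 1], and [A E = lambda E] becomes
    [A K = lambda K + beta J], i.e. the partition is indubitable.  Conversely, for
    a full indubitable partition [K / s - J / v] is a symmetric idempotent of rank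
    [m] with rows in the eigenspace, so it is [E]. *)
Require Import Defs.
From mathcomp Require Import all_boot all_order all_fingroup all_algebra.
From mathcomp Require Import reals.
From mathcomp Require Import mxtens.
From mathcomp Require Import ring lra.
Set Implicit Arguments.
Unset Strict Implicit.
Unset Printing Implicit Defensive.
Import Order.TTheory GRing.Theory Num.Theory.
Local Open Scope ring_scope.

(** * Orthogonal projections onto a row space, and the spectral idempotent *)

Section OrthogonalProjection.
Variables (R : realType) (n : nat).
Implicit Types (U E F : 'M[R]_n).

(** The diagonal entries of [M *m M^T] are the sums of squares of the rows of [M]. *)
Lemma mulmx_tr_eq0 p (M : 'M[R]_(p, n)) : M *m M^T = 0 -> M = 0.
Proof.
move=> MM0; apply/matrixP => i j; rewrite mxE.
have := congr1 (fun N : 'M_p => N i i) MM0; rewrite !mxE.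
move/eqP; rewrite psumr_eq0 => [/allP/(_ j (mem_index_enum j)) /implyP/(_ isT)|k _].
  by rewrite mxE mulf_eq0 orbb => /eqP.
by rewrite mxE -expr2 sqr_ge0.
Qed.

(** Writing [M = D *m U] turns [M *m M^T] into [M *m U^T *m D^T = 0]. *)
Lemma sub_orthogonal_eq0 p U (M : 'M[R]_(p, n)) :
  (M <= U)%MS -> M *m U^T = 0 -> M = 0.
Proof.
move=> /submxP[D defM] MU0; apply: mulmx_tr_eq0.
by rewrite {2}defM trmx_mul mulmxA MU0 mul0mx.
Qed.

Lemma capmx_orthogonal U : (U :&: kermx U^T)%MS = 0.
Proof.
apply: (@sub_orthogonal_eq0 _ U); first exact: capmxSl.
by apply/sub_kermxP; exact: capmxSr.
Qed.

(** Dimension count: the two summands meet trivially and their ranks add up to [n]. *)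
Lemma addsmx_orthogonal p U (M : 'M[R]_(p, n)) : (M <= U + kermx U^T)%MS.
Proof.
apply: submx_full; rewrite /row_full.
have := mxrank_sum_cap U (kermx U^T).
rewrite capmx_orthogonal mxrank0 addn0 mxrank_ker mxrank_tr => ->.
by rewrite subnKC ?rank_leq_row.
Qed.

(** The difference of two such matrices has its rows in [U] and is orthogonal to [U], so it
    vanishes. *)
Lemma orthogonal_projection_unique U F :
  (F <= U)%MS -> (1%:M - F) *m U^T = 0 -> F = proj_mx U (kermx U^T).
Proof.
move=> FU F'U; set E := proj_mx _ _.
have EU : (E <= U)%MS by rewrite -[E]mul1mx proj_mx_sub.
have E'U : (1%:M - E) *m U^T = 0.
  apply/sub_kermxP; rewrite -[E]mul1mx.
  exact/proj_mx_compl_sub/addsmx_orthogonal.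
apply/eqP; rewrite -subr_eq0; apply/eqP; apply: (@sub_orthogonal_eq0 _ U).
  by rewrite addmx_sub ?eqmx_opp.
have -> : F - E = (1%:M - E) - (1%:M - F) by rewrite opprB [RHS]addrC addrA subrK.
by rewrite mulmxBl E'U F'U subrr.
Qed.

(** In a rank factorization [E = C *m B], idempotency cancels to [B *m C = 1], an identity matrix of
    size [\rank E]; its trace is that of [C *m B]. *)
Lemma idempotent_trace E : E *m E = E -> \tr E = (\rank E)%:R.
Proof.
move=> EE.
move: (col_base E) (row_base E) (row_base_free E) (col_base_full E)
  (mulmx_base E) => C B freeB fullC defE.
rewrite -{1}defE mxtrace_mulC.
suff -> : B *m C = 1%:M by rewrite mxtrace1.
apply: (row_free_inj freeB); apply: (row_full_inj fullC).
by rewrite mul1mx !mulmxA defE -mulmxA defE.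
Qed.

Variables (A : 'M[R]_n) (lambda : R).
Let E := spectral_idempotent A lambda.

Lemma spectral_idempotent_sub : (E <= eigenspace A lambda)%MS.
Proof. by rewrite -[E]mul1mx proj_mx_sub. Qed.

Lemma spectral_idempotent_id p (M : 'M[R]_(p, n)) :
  (M <= eigenspace A lambda)%MS -> M *m E = M.
Proof. by apply: proj_mx_id; exact: capmx_orthogonal. Qed.

Lemma spectral_idempotentK : E *m E = E.
Proof. exact/spectral_idempotent_id/spectral_idempotent_sub. Qed.

(** The rows of [1 - E] are orthogonal to the eigenspace, which contains the rows of [E]. Hence
    [E^T = E *m E^T], and the right-hand side is symmetric. *)
Lemma tr_spectral_idempotent : E^T = E.
Proof.
have /submxP[D defE] := spectral_idempotent_sub.
have E'E : (1%:M - E) *m E^T = 0.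
  rewrite {2}defE trmx_mul mulmxA.
  suff -> : (1%:M - E) *m (eigenspace A lambda)^T = 0 by rewrite mul0mx.
  apply/sub_kermxP; rewrite -[E]mul1mx.
  exact/proj_mx_compl_sub/addsmx_orthogonal.
have tE : E^T = E *m E^T.
  by apply/eqP; rewrite -subr_eq0 -{1}[E^T]mul1mx -mulmxBl E'E.
move: {E'E defE} (E) tE => F tF.
by have := congr1 trmx tF; rewrite trmx_mul !trmxK -tF.
Qed.

Lemma spectral_idempotent_eig : E *m A = lambda *: E.
Proof. exact/eigenspaceP/spectral_idempotent_sub. Qed.

Lemma rank_spectral_idempotent : \rank E = multiplicity A lambda.
Proof.
apply/eqP; rewrite eqn_leq mxrankS ?spectral_idempotent_sub //=.
rewrite /multiplicity -{1}(spectral_idempotent_id (submx_refl _)).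
exact: mxrankM_maxr.
Qed.

Lemma trace_spectral_idempotent : \tr E = (multiplicity A lambda)%:R.
Proof. by rewrite idempotent_trace ?spectral_idempotentK ?rank_spectral_idempotent. Qed.

(* A symmetric idempotent is the orthogonal projection onto its row space, and
   the rank condition forces that row space to be the whole eigenspace. *)
Lemma spectral_idempotent_eq F :
  F^T = F -> F *m F = F -> F *m A = lambda *: F ->
  \rank F = multiplicity A lambda -> F = E.
Proof.
move=> tF FF /eigenspaceP FU rF.
apply: orthogonal_projection_unique => //.
have UF : (eigenspace A lambda <= F)%MS.
  by have [_ <-] := mxrank_leqif_sup FU; rewrite rF.
have /submxP[D ->] := UF.
by rewrite trmx_mul mulmxA tF mulmxBl FF mul1mx subrr mul0mx.
Qed.

End OrthogonalProjection.

(** * Hadamard spans of dimension 2 and two-valued matrices *)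

Section HadamardSpan.
Variables (R : realType) (n : nat).
Implicit Types (E M : 'M[R]_n).

Lemma hadamard_powE E k i j : hadamard_pow E k i j = E i j ^+ k.
Proof.
elim: k => [|k IHk]; first by rewrite mxE expr0.
by rewrite /hadamard_pow iterS mxE -/(hadamard_pow E k) IHk exprS.
Qed.

(** Hadamard powers are entrywise powers, so the span is governed by the values of polynomials on
    the entries of [E]. *)
Lemma hadamard_spanP E M :
  hadamard_span E M <-> exists p : {poly R}, M = map_mx (horner p) E.
Proof.
split=> [[d [c ->]]|[p ->]].
  exists (\sum_(k < d) c k *: 'X^k); apply/matrixP => i j.
  rewrite summxE mxE horner_sum; apply: eq_bigr => k _.
  by rewrite mxE hadamard_powE hornerZ hornerXn.
exists (size p), (fun k => p`_k); apply/matrixP => i j.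
rewrite summxE mxE horner_coef; apply: eq_bigr => k _.
by rewrite mxE hadamard_powE.
Qed.

(** Being nonconstant excludes [E = 0], the empty matrix (hence [J = 0]), and [E] proportional to
    [J]. *)
Lemma dim_J_line E : (forall c, E <> const_mx c) ->
  \dim (<[const_mx 1%R]> + <[E]>) = 2.
Proof.
move=> nconst.
have E0 : E != 0 by apply/eqP => E0; apply: (nconst 0); rewrite E0.
have J0 : (const_mx 1 : 'M[R]_n) != 0.
  apply/eqP => J0; apply: (nconst 0); apply/matrixP=> i j.
  by have /matrixP/(_ i j)/eqP := J0; rewrite !mxE oner_eq0.
rewrite dimv_disjoint_sum ?dim_vline ?E0 ?J0 //.
apply/eqP; rewrite -subv0; apply/subvP => x /memv_capP[/vlineP[a ->]].
case/vlineP=> b ab; rewrite memv0 ab.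
have [->|b0] := eqVneq b 0; first by rewrite scale0r.
case: (nconst (b^-1 * a)); rewrite -[E]scale1r -(mulVf b0) -scalerA -ab.
by apply/matrixP => i j; rewrite !mxE mulr1.
Qed.

(* The Hadamard span always contains [J], [E] and [E o E]; if its dimension is
   2 these are linearly dependent, while [E] is not a multiple of [J]. *)
Lemma hadamard_span_dim2_values E : has_dim (hadamard_span E) 2 ->
  (forall c, E <> const_mx c) /\
  exists s t : R, forall i j, E i j = s \/ E i j = t.
Proof.
case=> U [memU dimU].
have JU : const_mx 1 \in U.
  apply/memU/hadamard_spanP; exists 1; apply/matrixP=> i j.
  by rewrite !mxE hornerE.
have EU : E \in U.
  apply/memU/hadamard_spanP; exists 'X; apply/matrixP=> i j.
  by rewrite !mxE hornerX.
have E2U : map_mx (fun x => x ^+ 2) E \in U.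
  apply/memU/hadamard_spanP; exists 'X^2; apply/matrixP=> i j.
  by rewrite !mxE hornerXn.
have nconst c : E <> const_mx c.
  (* For constant [E] every entrywise polynomial is a multiple of [J], so the dimension would be at
     most 1. *)
  move=> Ec; suff /dimvS : (U <= <[const_mx 1%R]>)%VS.
    by rewrite dimU dim_vline; case: (_ == _).
  apply/subvP => M /memU/hadamard_spanP[p ->]; apply/vlineP.
  by exists p.[c]; apply/matrixP=> i j; rewrite Ec !mxE mulr1.
split=> //.
have defU : U = (<[const_mx 1%R]> + <[E]>)%VS.
  by apply/esym/eqP; rewrite eqEdim subv_add -!memvE JU EU dimU dim_J_line.
move: E2U; rewrite defU => /memv_addP[_ /vlineP[b ->]] [_ /vlineP[a ->]] E2.
have quad i j : E i j ^+ 2 = b + a * E i j.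
  by have /matrixP/(_ i j) := E2; rewrite !mxE mulr1.
(* The other root of the quadratic is read off one entry, by Vieta. *)
have [[i j]|none] := pickP [pred ij : 'I_n * 'I_n | true].
  move=> _; exists (E i j), (a - E i j) => k l.
  have : (E k l - E i j) * (E k l - (a - E i j)) = 0.
    have := quad i j; have := quad k l; rewrite !expr2; nra.
  by move/eqP; rewrite mulf_eq0 !subr_eq0 => /orP[]/eqP; [left|right].
by exists 0, 0 => i j; have := none (i, j).
Qed.

(** On the two values [s] and [t] every polynomial agrees with one of degree at most 1, so [J] and
    [E] already span. *)
Lemma hadamard_span_dim2 E (s t : R) :
  (forall c, E <> const_mx c) -> (forall i j, E i j = s \/ E i j = t) ->
  has_dim (hadamard_span E) 2.
Proof.
move=> nconst st.
have neq_st : s != t.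
  apply/eqP => eq_st; apply: (nconst s); apply/matrixP=> i j; rewrite mxE.
  by case: (st i j) => ->.
exists (<[const_mx 1%R]> + <[E]>)%VS; split=> [M|].
  split=> [/memv_addP[_ /vlineP[b ->]] [_ /vlineP[a ->]] ->|].
    apply/hadamard_spanP; exists (b%:P + a *: 'X); apply/matrixP => i j.
    by rewrite !mxE !hornerE.
  move=> /hadamard_spanP[p ->].
  (* Slope and intercept of the line interpolating [p] at [s] and [t]. *)
  pose a := (p.[s] - p.[t]) / (s - t); pose b := p.[s] - a * s.
  have -> : map_mx (horner p) E = b *: const_mx 1 + a *: E.
    apply/matrixP => i j; rewrite !mxE mulr1 /b /a.
    have s't : s - t != 0 by rewrite subr_eq0.
    by case: (st i j) => ->; field.
  by rewrite memv_add ?memvZ ?memv_line.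
exact: dim_J_line.
Qed.

End HadamardSpan.

(** * The matrix of a partition, and the idempotent of a uniform partition *)

Section PartitionMatrix.
Variables (R : realType) (T : finType).
Implicit Types (Pi : {set {set T}}).
Local Notation J := (J_mx R #|T|).
Local Notation v := (#|T|%:R : R).

Lemma sum_enum_val (F : T -> R) :
  \sum_(i < #|T|) F (enum_val i) = \sum_(x : T) F x.
Proof. by rewrite [RHS](reindex _ (onW_bij _ (enum_val_bij T))). Qed.

Lemma sum_indicator (P : pred T) :
  \sum_(i < #|T|) (P (enum_val i))%:R = #|[set x | P x]|%:R :> R.
Proof.
rewrite (sum_enum_val (fun x => (P x)%:R)) -sum1_card natr_sum [RHS]big_mkcond /=.
by apply: eq_bigr => x _; rewrite inE; case: (P x).
Qed.

Definition partition_mx Pi : 'M[R]_#|T| :=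
  \matrix_(i, j) (pblock Pi (enum_val i) == pblock Pi (enum_val j))%:R.

(** When all cells have size [s], this is the orthogonal projection onto the vectors that are
    constant on cells and have zero sum. *)
Definition partition_idem Pi (s : nat) : 'M[R]_#|T| :=
  s%:R^-1 *: partition_mx Pi - v^-1 *: J.

Lemma mulJJ : J *m J = v *: J.
Proof.
apply/matrixP => i j; rewrite !mxE (eq_bigr (fun=> 1)) => [|k _].
  by rewrite sumr_const card_ord mulr1.
by rewrite !mxE mulr1.
Qed.

Lemma tr_partition_mx Pi : (partition_mx Pi)^T = partition_mx Pi.
Proof. by apply/matrixP => i j; rewrite !mxE eq_sym. Qed.

Lemma tr_partition_idem Pi s : (partition_idem Pi s)^T = partition_idem Pi s.
Proof.
by rewrite /partition_idem linearB /= ![(_ *: _)^T]linearZ /= tr_partition_mx trmx_const.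
Qed.

Variable Pi : {set {set T}}.
Hypothesis Pi_part : partition Pi [set: T].

Lemma mem_pblockE x y : (y \in pblock Pi x) = (pblock Pi x == pblock Pi y).
Proof.
have /and3P[/eqP covPi trivPi _] := Pi_part.
by rewrite eq_pblock // covPi inE.
Qed.

Lemma partition_pblock_mem x : pblock Pi x \in Pi.
Proof.
have /and3P[/eqP covPi _ _] := Pi_part.
by rewrite pblock_mem // covPi inE.
Qed.

Lemma partition_blockP C : C \in Pi -> exists x, C = pblock Pi x.
Proof.
have /and3P[_ trivPi nPi] := Pi_part.
move=> CPi; have /set0Pn[x xC] : C != set0.
  by apply: contraNneq nPi => <-.
by exists x; rewrite (def_pblock trivPi CPi xC).
Qed.

Lemma sum_partition_mx i :
  \sum_j partition_mx Pi i j = #|pblock Pi (enum_val i)|%:R.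
Proof.
under eq_bigr do rewrite mxE.
rewrite (sum_indicator (fun y => pblock Pi (enum_val i) == pblock Pi y)).
by congr (_%:R); apply: eq_card => y; rewrite inE mem_pblockE.
Qed.

Lemma mul_partition_mx_J i j :
  (partition_mx Pi *m J) i j = #|pblock Pi (enum_val i)|%:R.
Proof.
by rewrite -sum_partition_mx mxE; apply: eq_bigr => k _; rewrite [J _ _]mxE mulr1.
Qed.

Variable s : nat.
Hypotheses (T_gt0 : (0 < #|T|)%N) (s_gt0 : (0 < s)%N)
  (Pi_unif : {in Pi, forall C : {set T}, #|C| = s}).

Let s0 : s%:R != 0 :> R.
Proof. by rewrite pnatr_eq0 -lt0n. Qed.

Let v0 : v != 0.
Proof. by rewrite pnatr_eq0 -lt0n. Qed.

Lemma partition_mx_J : partition_mx Pi *m J = s%:R *: J.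
Proof.
apply/matrixP => i j.
by rewrite mul_partition_mx_J Pi_unif ?partition_pblock_mem // !mxE mulr1.
Qed.

Lemma partition_J_mx : J *m partition_mx Pi = s%:R *: J.
Proof.
apply: trmx_inj; rewrite trmx_mul tr_partition_mx trmx_const partition_mx_J.
by rewrite linearZ /= trmx_const.
Qed.

Lemma partition_mxK : partition_mx Pi *m partition_mx Pi = s%:R *: partition_mx Pi.
Proof.
apply/matrixP => i j; rewrite mxE.
rewrite (eq_bigr (fun k => partition_mx Pi i k * partition_mx Pi i j)) => [|k _].
  by rewrite -mulr_suml sum_partition_mx Pi_unif ?partition_pblock_mem // [RHS]mxE.
rewrite !mxE; case: eqP => [->|_]; last by rewrite !mul0r.
by rewrite !mul1r.
Qed.

(** [K / s] and [J / v] are idempotents whose product in either order is [J / v], so their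
    difference is idempotent. *)
Lemma partition_idemK :
  partition_idem Pi s *m partition_idem Pi s = partition_idem Pi s.
Proof.
rewrite /partition_idem mulmxBl !mulmxBr -!scalemxAl -!scalemxAr.
rewrite partition_mxK partition_mx_J partition_J_mx mulJJ !scalerA.
by rewrite !mulfVK // subrr subr0 mulrAC mulVf // mul1r.
Qed.

Lemma partition_idem_J : partition_idem Pi s *m J = 0.
Proof.
rewrite /partition_idem mulmxBl -!scalemxAl partition_mx_J mulJJ !scalerA.
by rewrite !mulVf // subrr.
Qed.

Lemma card_unif_partition : #|T| = (#|Pi| * s)%N.
Proof. by rewrite -cardsT (card_uniform_partition Pi_unif Pi_part). Qed.

Lemma trace_partition_idem :
  \tr (partition_idem Pi s) = #|Pi|%:R - 1.
Proof.
rewrite /mxtrace (eq_bigr (fun=> s%:R^-1 - v^-1)) => [|i _].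
  rewrite sumr_const card_ord -[LHS]mulr_natr mulrBl mulVf //.
  by rewrite card_unif_partition natrM mulrC mulfK.
by rewrite !mxE eqxx !mulr1.
Qed.

Lemma partition_idem_dim2 : (2 <= #|Pi|)%N ->
  has_dim (hadamard_span (partition_idem Pi s)) 2.
Proof.
move=> Pi_gt1.
apply: (@hadamard_span_dim2 _ _ _ (s%:R^-1 - v^-1) (- v^-1)) => [c Fc|i j].
  (* If all entries were equal, the trace would be a row sum, which is 0; but the trace is
     [#|Pi| - 1]. *)
  have : \tr (partition_idem Pi s) = 0.
    pose i0 := Ordinal T_gt0.
    rewrite /mxtrace -[RHS](_ : (partition_idem Pi s *m J) i0 i0 = 0).
      by rewrite mxE; apply: eq_bigr => i _; rewrite Fc !mxE mulr1.
    by rewrite partition_idem_J mxE.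
  rewrite trace_partition_idem // => /eqP; rewrite subr_eq0 pnatr_eq1 => /eqP Pi1.
  by rewrite Pi1 in Pi_gt1.
by rewrite !mxE; case: eqP => _; rewrite !(mulr1, mulr0) ?sub0r; [left|right].
Qed.

End PartitionMatrix.

(** * Permutation similarity with the tensor product [I *t J] *)

Section PermutationSimilarity.
Variable R : realType.

(** Equal fiber sizes mean that the value lists of [c] and [d] agree as multisets; a permutation
    between the lists is the required [q]. *)
Lemma equal_fibers_perm (n p : nat) (c d : 'I_n -> 'I_p) :
  (forall a, #|[set i | c i == a]| = #|[set i | d i == a]|) ->
  exists q : {perm 'I_n}, forall i, d i = c (q i).
Proof.
move=> cd.
have cnt (f : 'I_n -> 'I_p) a :
    count_mem a [tuple f i | i < n] = #|[set i | f i == a]|.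
  rewrite /= count_map cardsE cardE /enum_mem size_filter.
  by rewrite count_filter; apply: eq_count => i; rewrite /= andbT.
have /tuple_permP[q dq] : perm_eq [tuple d i | i < n] [tuple c i | i < n].
  by apply/allP => a _ /=; rewrite !cnt cd.
exists q => i; have := congr1 (fun t : seq _ => nth (d i) t i) dq.
by rewrite -!tnth_nth !tnth_mktuple.
Qed.

(** The tensor product is the matrix of the relation of having the same first coordinate. The fibers
    of that coordinate have size [s], like those of [c], so a permutation carries one relation to
    the other. *)
Lemma perm_similar_tensor (n p s : nat) (K : 'M[R]_n) (c : 'I_n -> 'I_p)
    (hv : (p * s)%N = n) :
  (forall i j, K i j = (c i == c j)%:R) ->
  (forall a, #|[set i | c i == a]| = s) ->
  perm_similar K (castmx (hv, hv) ((1%:M : 'M[R]_p) *t J_mx R s)).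
Proof.
case: n / hv K c => K c Kc cs; rewrite castmx_id.
pose d (i : 'I_(p * s)) := (mxtens_unindex i).1.
have [|q dq] := @equal_fibers_perm _ _ c d.
  move=> a; rewrite cs -{1}(card_ord s).
  rewrite -(card_imset predT (f := fun k => mxtens_index (a, k))).
    apply: eq_card => i; rewrite inE /d; apply/imsetP/eqP => [[k _ ->]|<-].
      by rewrite mxtens_indexK.
    by exists (mxtens_unindex i).2; rewrite // -surjective_pairing mxtens_unindexK.
  by move=> k l /(congr1 (@mxtens_unindex p s)); rewrite !mxtens_indexK => -[].
exists (perm_mx q^-1); split; first exact: perm_mx_is_perm.
rewrite tr_perm_mx invgK -row_permE -col_permE.
apply/matrixP => i j; rewrite !mxE Kc -!dq mulr1.
by rewrite /d.
Qed.

Lemma perm_similar_partition_mx (T : finType) (Pi : {set {set T}}) (p s : nat)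
    (hv : (p * s)%N = #|T|) :
  partition Pi [set: T] -> {in Pi, forall C : {set T}, #|C| = s} -> #|Pi| = p ->
  perm_similar (partition_mx R Pi)
    (castmx (hv, hv) ((1%:M : 'M[R]_p) *t J_mx R s)).
Proof.
move=> Pi_part Pi_unif card_Pi; case: p / card_Pi hv => hv.
have memPi := partition_pblock_mem Pi_part.
pose c (i : 'I_#|T|) := enum_rank_in (memPi (enum_val i)) (pblock Pi (enum_val i)).
have cE i : enum_val (c i) = pblock Pi (enum_val i) by rewrite enum_rankK_in.
apply: (@perm_similar_tensor _ _ _ _ c) => [i j|a].
  by rewrite mxE -!cE (inj_eq enum_val_inj).
rewrite -(Pi_unif _ (enum_valP a)) -(card_imset _ enum_val_inj).
have /and3P[_ trivPi _] := Pi_part.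
apply: eq_card => x; apply/imsetP/idP => [[i + ->]|xa].
  rewrite inE => /eqP <-; rewrite cE mem_pblockE //.
exists (enum_rank x); rewrite ?enum_rankK // inE -(inj_eq enum_val_inj) cE.
by rewrite enum_rankK (def_pblock trivPi (enum_valP a) xa).
Qed.

End PermutationSimilarity.

(** * A two-valued symmetric idempotent with zero row sums comes from a uniform partition *)

Section TwoValuedProjection.
Variables (R : realType) (T : finType) (E : 'M[R]_#|T|).
Local Notation J := (J_mx R #|T|).
Hypotheses (tE : E^T = E) (EE : E *m E = E) (EJ : E *m J = 0).

Let Esym i j : E i j = E j i.
Proof. by rewrite -{1}tE mxE. Qed.

Let Erow i : \sum_j E i j = 0.
Proof.
have /matrixP/(_ i i) := EJ; rewrite !mxE => {2}<-.
by apply: eq_bigr => j _; rewrite mxE mulr1.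
Qed.

Let Egram i j : E i j = \sum_k E i k * E j k.
Proof. by rewrite -{1}EE mxE; apply: eq_bigr => k _; rewrite [E j k]Esym. Qed.

Lemma projection_diag_ge0 i : 0 <= E i i.
Proof. by rewrite Egram sumr_ge0 // => k _; rewrite -expr2 sqr_ge0. Qed.

(** [E i i] is the squared norm of row [i]. *)
Lemma projection_row_eq0 i j : E i i = 0 -> E i j = 0.
Proof.
move/eqP; rewrite Egram psumr_eq0 => [/allP/(_ j (mem_index_enum j))|k _].
  by rewrite /= mulf_eq0 orbb => /eqP.
by rewrite -expr2 sqr_ge0.
Qed.

(** Some diagonal entry is positive, since otherwise all rows vanish; its row sums to zero, so it
    also has a negative entry. These two entries exhaust the values. *)
Lemma two_valued_projection_signs (s t : R) :
  E <> 0 -> (forall i j, E i j = s \/ E i j = t) ->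
  exists p q, [/\ 0 < p, q < 0 & forall i j, E i j = p \/ E i j = q].
Proof.
move=> E0 st.
have [k Ekk] : exists k, 0 < E k k.
  have [k Ek|diag0] := pickP (fun k => 0 < E k k); first by exists k.
  case: E0; apply/matrixP => i j; rewrite mxE projection_row_eq0 //.
  by apply/eqP; rewrite eq_le projection_diag_ge0 leNgt diag0.
have [l Ekl] : exists l, E k l < 0.
  have [l El|row0] := pickP (fun l => E k l < 0); first by exists l.
  have /eqP := Erow k; rewrite psumr_eq0 => [|l _]; last by rewrite leNgt row0.
  by move/allP/(_ k (mem_index_enum k)); rewrite /= gt_eqF.
exists (E k k), (E k l); split=> // i j.
by case: (st k k) (st k l) (st i j) Ekk Ekl => -> [] -> [] ->;
  move=> lt0 gt0; solve [by left | by right | by have := lt_trans lt0 gt0; rewrite ltxx].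
Qed.

Lemma two_valued_projection (s t : R) :
  E <> 0 -> (forall i j, E i j = s \/ E i j = t) ->
  exists (Pi : {set {set T}}) (r : nat),
    [/\ partition Pi [set: T], {in Pi, forall C : {set T}, #|C| = r}, (0 < r)%N
      & E = partition_idem R Pi r].
Proof.
move=> E0 st.
have [p [q [p_gt0 q_lt0 pq]]] := two_valued_projection_signs E0 st.
have neq_qp : q != p by rewrite lt_eqF // (lt_trans q_lt0).
have Ediag i : E i i = p.
  by case: (pq i i) => // Eq; have := projection_diag_ge0 i; rewrite Eq leNgt q_lt0.
(* The rows of [E] are vectors whose Gram matrix is [E] itself, so rows with
   inner product [p = E i i = E j j] coincide. *)
have rowE i j : E i j = p -> forall l, E i l = E j l.
  move=> Eij l; have : \sum_k (E i k - E j k) ^+ 2 = 0.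
    rewrite (eq_bigr (fun k => E i k * E i k + E j k * E j k - 2 * (E i k * E j k))).
      by rewrite sumrB big_split /= -mulr_sumr -!Egram !Ediag Eij; ring.
    by move=> k _; ring.
  move/eqP; rewrite psumr_eq0 => [/allP/(_ l (mem_index_enum l))|k _].
    by rewrite /= sqrf_eq0 subr_eq0 => /eqP.
  exact: sqr_ge0.
pose r := [rel x y : T | E (enum_rank x) (enum_rank y) == p].
have r_equiv : {in [set: T] & &, equivalence_rel r}.
  move=> x y z _ _ _; split; first by rewrite /r /= Ediag.
  by move=> /eqP/rowE rxy; rewrite /r /= rxy.
pose Pi := equivalence_partition r [set: T].
have Pi_part : partition Pi [set: T] by exact: equivalence_partitionP.
have KE i j : partition_mx R Pi i j = (E i j == p)%:R.
  rewrite mxE -mem_pblockE // pblock_equivalence_partition ?inE //.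
  by rewrite /r /= !enum_valK.
have Eval i j : E i j = q + (p - q) * partition_mx R Pi i j.
  by rewrite KE; case: (pq i j) => ->; rewrite ?eqxx ?(negPf neq_qp) /=; ring.
have Kval i j : E i j ^+ 2 = q ^+ 2 + (p ^+ 2 - q ^+ 2) * partition_mx R Pi i j.
  by rewrite KE; case: (pq i j) => ->; rewrite ?eqxx ?(negPf neq_qp) /=; ring.
(* Zero row sum, expressed through the size of the cell of [i]. *)
have rsum (i : 'I_#|T|) : q * #|T|%:R + (p - q) * #|pblock Pi (enum_val i)|%:R = 0.
  rewrite -(sum_partition_mx R Pi_part) mulr_sumr mulr_natr -[X in _ *+ X]card_ord.
  by rewrite -sumr_const -big_split /= -[RHS](Erow i); apply: eq_bigr => j _.
(* Squared norm of row [i], which is [E i i = p]. *)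
have rsum2 (i : 'I_#|T|) : q ^+ 2 * #|T|%:R
    + (p ^+ 2 - q ^+ 2) * #|pblock Pi (enum_val i)|%:R = p.
  rewrite -(sum_partition_mx R Pi_part) mulr_sumr mulr_natr -[X in _ *+ X]card_ord.
  rewrite -sumr_const -big_split /= -[RHS](Ediag i) Egram.
  by apply: eq_bigr => j _; rewrite -Kval expr2.
have [i0 _|T0] := pickP 'I_#|T|; last first.
  by case: E0; apply/matrixP => i; have := T0 i.
clear E0; pose s0 := #|pblock Pi (enum_val i0)|.
have qT : q * #|T|%:R = -1.
  (* Multiplying [rsum] by [p + q] and subtracting [rsum2] eliminates the cell size. *)
  have: p * (q * #|T|%:R + 1) = 0.
    by have := rsum i0; have := rsum2 i0; nra.
  by move/eqP; rewrite mulf_eq0 gt_eqF //= addr_eq0 => /eqP.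
have ps0 : (p - q) * s0%:R = 1.
  by have := rsum i0; rewrite qT -/s0; lra.
have T0 : #|T|%:R != 0 :> R.
  by apply/eqP => T0; move: qT; rewrite T0 mulr0; lra.
have s00 : s0%:R != 0 :> R.
  by apply/eqP => s00; move: ps0; rewrite s00 mulr0; lra.
exists Pi, s0; split=> //.
- move=> C /(partition_blockP Pi_part)[x ->]; apply/eqP.
  (* By [rsum] and [qT], every cell size is the inverse of [p - q], as for [s0]. *)
  have p'q : p - q != 0 by rewrite subr_eq0 eq_sym.
  rewrite -(eqr_nat R) -(inj_eq (mulfI p'q)) ps0.
  by have := rsum (enum_rank x); rewrite enum_rankK qT => /eqP; rewrite addrC subr_eq0.
- by rewrite lt0n -(pnatr_eq0 R).
apply/matrixP => i j; rewrite Eval !mxE mulr1.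
have -> : q = - #|T|%:R^-1 by rewrite -[LHS](mulfK T0) qT mulN1r.
have -> : p - - #|T|%:R^-1 = s0%:R^-1.
  have -> : - #|T|%:R^-1 = q by rewrite -[RHS](mulfK T0) qT mulN1r.
  by rewrite -[LHS](mulfK s00) ps0 mul1r.
by rewrite addrC.
Qed.

End TwoValuedProjection.

(** * The adjacency matrix of a connected regular graph and its valency eigenvectors *)

Section Graph.
Variables (R : realType) (T : finType) (e : rel T).
Hypotheses (e_simple : simple_graph e) (e_conn : connected_graph e).
Local Notation A := (adjmx e R).
Local Notation J := (J_mx R #|T|).

Lemma tr_adjmx : A^T = A.
Proof. by apply/matrixP => i j; rewrite !mxE e_simple.1. Qed.

Lemma adjmx_J k : (forall x, #|[set y | e x y]| = k) -> A *m J = k%:R *: J.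
Proof.
move=> e_reg; apply/matrixP => i j; rewrite !mxE mulr1.
rewrite -(e_reg (enum_val i)) -sum_indicator.
by apply: eq_bigr => l _; rewrite !mxE mulr1.
Qed.

Lemma adjmx_partition_mx Pi : partition Pi [set: T] -> forall i j,
  (A *m partition_mx R Pi) i j =
  #|[set y in pblock Pi (enum_val j) | e (enum_val i) y]|%:R.
Proof.
move=> Pi_part i j; rewrite mxE.
rewrite -(sum_indicator R (fun y => (y \in pblock Pi (enum_val j)) && e (enum_val i) y)).
apply: eq_bigr => l _; rewrite !mxE mem_pblockE // eq_sym -natrM mulnb andbC.
by rewrite eq_sym.
Qed.

(* Summing the quadratic form of [k - A]: the Dirichlet energy
   [\sum_(x ~ y) (u x - u y)^2] of a [k]-eigenvector vanishes. *)
Lemma valency_eigenvector_const k (u : 'rV[R]_#|T|) :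
  (forall x, #|[set y | e x y]| = k) -> u *m A = k%:R *: u ->
  forall i j, u 0 i = u 0 j.
Proof.
move=> e_reg uA.
have deg i : \sum_j A i j = k%:R.
  rewrite -(e_reg (enum_val i)) -sum_indicator.
  by apply: eq_bigr => l _; rewrite !mxE.
have Asym i j : A i j = A j i by rewrite -{1}tr_adjmx mxE.
have degr j : \sum_i A i j = k%:R by rewrite -(deg j); apply: eq_bigr => i _.
have energy : \sum_i \sum_j A i j * (u 0 i - u 0 j) ^+ 2 = 0.
  (* After expanding the square, both square sums equal [k] times the squared norm of [u] by
     regularity, and so does the cross sum by the eigenvector equation. *)
  have -> : \sum_i \sum_j A i j * (u 0 i - u 0 j) ^+ 2 =
      \sum_i \sum_j u 0 i ^+ 2 * A i j + \sum_i \sum_j u 0 j ^+ 2 * A i j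
      - 2 * \sum_i \sum_j u 0 i * A i j * u 0 j.
    rewrite mulr_sumr -big_split -sumrB /=; apply: eq_bigr => i _.
    by rewrite mulr_sumr -big_split -sumrB /=; apply: eq_bigr => j _; ring.
  rewrite [X in _ + X - _]exchange_big [X in _ - 2 * X]exchange_big /=.
  have -> : \sum_j \sum_i u 0 i * A i j * u 0 j = \sum_j k%:R * u 0 j ^+ 2.
    apply: eq_bigr => j _.
    rewrite -mulr_suml; have /rowP/(_ j) := uA; rewrite !mxE => ->.
    by rewrite -mulrA expr2.
  have -> : \sum_i \sum_j u 0 i ^+ 2 * A i j = \sum_j k%:R * u 0 j ^+ 2.
    by apply: eq_bigr => i _; rewrite -mulr_sumr deg mulrC.
  have -> : \sum_j \sum_i u 0 j ^+ 2 * A i j = \sum_j k%:R * u 0 j ^+ 2.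
    by apply: eq_bigr => i _; rewrite -mulr_sumr degr mulrC.
  by ring.
have term0 i j : 0 <= A i j * (u 0 i - u 0 j) ^+ 2.
  by rewrite mulr_ge0 ?sqr_ge0 // mxE ler0n.
have adj x y : e x y -> u 0 (enum_rank x) = u 0 (enum_rank y).
  move=> exy; move/eqP: energy; rewrite psumr_eq0 => [|i _]; last exact: sumr_ge0.
  move=> /allP/(_ (enum_rank x) (mem_index_enum _)) /=.
  rewrite psumr_eq0 // => /allP/(_ (enum_rank y) (mem_index_enum _)) /=.
  by rewrite mxE !enum_rankK exy mul1r sqrf_eq0 subr_eq0 => /eqP.
move=> i j.
(* The level set of [u] through [i] is closed under adjacency, hence is everything by
   connectedness. *)
pose same := [pred y | u 0 (enum_rank y) == u 0 i].
have same_closed : closed e same.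
  by move=> x y /adj; rewrite !inE => ->.
have := closed_connect same_closed (e_conn (enum_val i) (enum_val j)).
by rewrite !inE !enum_valK eqxx => /esym/eqP.
Qed.

(** * Passing between the idempotent of the graph and its indubitable partitions *)

Section Spectrum.
Variables (k : nat) (lambda : R).
Hypotheses (e_reg : forall x, #|[set y | e x y]| = k) (T_gt0 : (0 < #|T|)%N).
Local Notation E := (spectral_idempotent A lambda).
Local Notation m := (multiplicity A lambda).

Lemma adjmx_spectral_idempotent : A *m E = lambda *: E.
Proof.
apply: trmx_inj; rewrite trmx_mul tr_adjmx tr_spectral_idempotent.
by rewrite spectral_idempotent_eig linearZ /= tr_spectral_idempotent.
Qed.

(** Each row of [E] is a valency eigenvector, hence constant; symmetry then makes all rows equal. *)
Lemma spectral_idempotent_valency : lambda = k%:R -> exists c, E = const_mx c.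
Proof.
move=> lk; exists (E (Ordinal T_gt0) (Ordinal T_gt0)); apply/matrixP => i j.
have rowE a b b' : E a b = E a b'.
  have := @valency_eigenvector_const k (row a E) e_reg.
  rewrite -row_mul spectral_idempotent_eig lk linearZ /= => /(_ erefl b b').
  by rewrite !mxE.
have Esym a b : E a b = E b a by rewrite -{1}tr_spectral_idempotent mxE.
by rewrite [RHS]mxE (rowE i j (Ordinal T_gt0)) Esym; exact: rowE.
Qed.

(** Evaluating [E *m A *m J] in two ways gives both [lambda *: (E *m J)] and [k%:R *: (E *m J)]. *)
Lemma spectral_idempotent_J : lambda != k%:R -> E *m J = 0.
Proof.
move=> lk; apply/eqP; have : (lambda - k%:R) *: (E *m J) = 0.
  rewrite scalerBl scalemxAl -spectral_idempotent_eig -mulmxA (adjmx_J e_reg).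
  by rewrite -scalemxAr subrr.
by move/eqP; rewrite scaler_eq0 subr_eq0 (negPf lk).
Qed.

Lemma spectral_dim2_partition : has_dim (hadamard_span E) 2 ->
  exists (Pi : {set {set T}}) (s : nat),
    [/\ partition Pi [set: T], {in Pi, forall C : {set T}, #|C| = s}, (0 < s)%N,
        E = partition_idem R Pi s & #|Pi| = m.+1].
Proof.
move=> /hadamard_span_dim2_values[nconst [a [b ab]]].
have lk : lambda != k%:R.
  by apply/eqP => /spectral_idempotent_valency[c]; exact: nconst.
have [||||Pi [s [Pi_part Pi_unif s_gt0 defE]]] :=
    @two_valued_projection R T E _ _ _ a b _ ab.
- exact: tr_spectral_idempotent.
- exact: spectral_idempotentK.
- exact: spectral_idempotent_J.
- by move=> E0; apply: (nconst 0); rewrite E0.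
exists Pi, s; split=> //.
(* The trace of [E] is [m] as a spectral idempotent and [#|Pi| - 1] as a partition idempotent. *)
have := trace_partition_idem R Pi_part T_gt0 s_gt0 Pi_unif.
rewrite -defE trace_spectral_idempotent => /eqP.
by rewrite eq_sym subr_eq natr1 eqr_nat => /eqP.
Qed.

Lemma partition_idem_indubitable Pi s :
  partition Pi [set: T] -> {in Pi, forall C : {set T}, #|C| = s} -> (0 < s)%N ->
  E = partition_idem R Pi s -> #|Pi| = m.+1 -> (0 < m)%N ->
  full_indubitable e lambda Pi.
Proof.
move=> Pi_part Pi_unif s_gt0 defE card_Pi m_gt0.
have s0 : s%:R != 0 :> R by rewrite pnatr_eq0 -lt0n.
(* Solving for [K] gives [K = s E + (s / v) J]; applying [A] leaves [(k - lambda) s / v] as the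
   coefficient of [J] beside [lambda K]. *)
pose beta := s%:R * (k%:R - lambda) / #|T|%:R.
have AK : A *m partition_mx R Pi = lambda *: partition_mx R Pi + beta *: J.
  have defK : partition_mx R Pi = s%:R *: E + (s%:R / #|T|%:R) *: J.
    by rewrite defE scalerBr !scalerA mulfV // scale1r subrK.
  rewrite {1}defK mulmxDr -!scalemxAr (adjmx_J e_reg) adjmx_spectral_idempotent.
  rewrite defK scalerDr !scalerA -addrA -scalerDl (mulrC lambda s%:R).
  by congr (_ + _ *: _); rewrite /beta; ring.
have cnt C x : C \in Pi ->
    #|[set y in C | e x y]|%:R = lambda * (x \in C)%:R + beta.
  move=> /(partition_blockP Pi_part)[y ->].
  have := adjmx_partition_mx Pi_part (enum_rank x) (enum_rank y).
  rewrite !enum_rankK => <-; rewrite AK !mxE mulr1 !enum_rankK.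
  by rewrite mem_pblockE // eq_sym.
have [C CPi] : exists C, C \in Pi by apply/card_gt0P; rewrite card_Pi.
have [D DPi] : exists2 D, D \in Pi & D != C.
  have : (0 < #|Pi :\ C|)%N.
    by rewrite (cardsD1 C) CPi add1n in card_Pi; case: card_Pi => ->.
  by case/card_gt0P=> D; rewrite !inE => /andP[]; exists D.
have [x xC] := partition_blockP Pi_part CPi; move=> DC.
have xinC : x \in C by rewrite xC mem_pblockE.
have xD : x \notin D.
  have /and3P[_ trivPi _] := Pi_part.
  by apply: contra DC => xD; rewrite xC (def_pblock trivPi DPi xD).
(* By [cnt] a count depends only on whether the vertex lies in the cell, so the natural numbers [a]
   and [b] are read off at one vertex [x], in its own cell [C] and in another cell [D]. *)
exists #|[set y in C | e x y]|, #|[set y in D | e x y]|; split.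
- split=> // B y BPi; apply/eqP; rewrite -(eqr_nat R) cnt //.
  by case: ifP => _; rewrite cnt // ?xinC ?(negPf xD).
- by rewrite card_Pi.
- by rewrite !cnt // xinC (negPf xD) /=; ring.
- exact: card_Pi.
Qed.

(** With [b = 0] no edge leaves a cell, so by connectedness there would be only one cell. *)
Lemma indubitable_b_gt0 Pi a b :
  indubitable e Pi a b -> (2 <= #|Pi|)%N -> (0 < b)%N.
Proof.
move=> [Pi_part cnt] Pi_gt1; rewrite lt0n; apply/eqP => b0.
have /and3P[_ trivPi _] := Pi_part.
have /card_gt1P[C [D [CPi DPi CD]]] := Pi_gt1.
have [x xC] := partition_blockP Pi_part CPi.
have [y yD] := partition_blockP Pi_part DPi.
have xinC : x \in C by rewrite xC mem_pblockE.
have yC : y \notin C.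
  by apply: contra CD => yC; rewrite yD (def_pblock trivPi CPi yC).
have stepC z w : e z w -> w \in C -> z \in C.
  move=> ezw wC; apply/negPn/negP => zC.
  have := cnt C z CPi; rewrite (negPf zC) b0 => /eqP.
  by rewrite cards_eq0 => /eqP/setP/(_ w); rewrite !inE wC ezw.
have C_closed : closed e C.
  move=> z w ezw; apply/idP/idP; last exact: stepC ezw.
  by apply: stepC; rewrite e_simple.1.
by have := closed_connect C_closed (e_conn x y); rewrite xinC (negPf yC).
Qed.

(* Comparing [K A K = (a - b) K^2 + b K J] with its transpose gives [K J = J K]. *)
Lemma indubitable_uniform Pi a b : indubitable e Pi a b -> (0 < b)%N ->
  A *m partition_mx R Pi = (a%:R - b%:R) *: partition_mx R Pi + b%:R *: J /\
  forall x y, #|pblock Pi x| = #|pblock Pi y|.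
Proof.
move=> [Pi_part cnt] b_gt0; set K := partition_mx R Pi.
have AK : A *m K = (a%:R - b%:R) *: K + b%:R *: J.
  apply/matrixP => i j; rewrite adjmx_partition_mx // cnt ?partition_pblock_mem //.
  rewrite mem_pblockE // !mxE mulr1 eq_sym.
  by case: (_ == _); rewrite /=; ring.
split=> // x y.
have tJ : J^T = J by rewrite trmx_const.
have tK : K^T = K by exact: tr_partition_mx.
have KAK : K *m A *m K = (a%:R - b%:R) *: (K *m K) + b%:R *: (K *m J).
  by rewrite -mulmxA AK mulmxDr -!scalemxAr.
have KAK' : K *m A *m K = (a%:R - b%:R) *: (K *m K) + b%:R *: (J *m K).
  have := congr1 trmx KAK.
  by rewrite linearD /= ![(_ *: _)^T]linearZ /= !trmx_mul tK tJ tr_adjmx mulmxA.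
have KJ : K *m J = J *m K.
  move: KAK'; rewrite KAK => /addrI/scalerI; apply.
  by rewrite pnatr_eq0 -lt0n.
apply/eqP; rewrite -(eqr_nat R); apply/eqP.
rewrite -[x]enum_rankK -[y]enum_rankK.
(* The entry of [K *m J] at [x], [y] is the size of the cell of [x]; that of [J *m K] is the size of
   the cell of [y]. *)
rewrite -(mul_partition_mx_J _ Pi_part _ (enum_rank y)) -/K KJ.
rewrite -(mul_partition_mx_J _ Pi_part _ (enum_rank x)) -/K.
by rewrite -[in LHS]tJ -[in LHS]tK -trmx_mul mxE.
Qed.

(** The matrix [K / s - J / v] meets the criteria of [spectral_idempotent_eq]; fullness supplies the
    rank. *)
Lemma full_indubitable_idem Pi : full_indubitable e lambda Pi ->
  exists s, [/\ partition Pi [set: T], {in Pi, forall C : {set T}, #|C| = s},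
    (0 < s)%N, (2 <= #|Pi|)%N & E = partition_idem R Pi s].
Proof.
move=> [a [b [ind Pi_gt1 lambdaE card_Pi]]].
have b_gt0 := indubitable_b_gt0 ind Pi_gt1.
have Pi_part := ind.1.
have [AK unif] := indubitable_uniform ind b_gt0; rewrite -lambdaE in AK.
have /card_gt0P[x0 _] := T_gt0.
pose s := #|pblock Pi x0|.
have Pi_unif : {in Pi, forall C : {set T}, #|C| = s}.
  by move=> C /(partition_blockP Pi_part)[x ->]; exact: unif.
have s_gt0 : (0 < s)%N by apply/card_gt0P; exists x0; rewrite mem_pblockE.
exists s; split=> //; apply/esym/spectral_idempotent_eq.
- exact: tr_partition_idem.
- exact: partition_idemK.
- have s0 : s%:R != 0 :> R by rewrite pnatr_eq0 -lt0n.
  have v0 : #|T|%:R != 0 :> R by rewrite pnatr_eq0 -lt0n.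
  (* Multiplying [A K = lambda K + b J] by [J] gives the relation that makes the [J] terms match
     below. *)
  have ks : k%:R * s%:R = lambda * s%:R + b%:R * #|T|%:R.
    have := congr1 (fun M => (M *m J) (Ordinal T_gt0) (Ordinal T_gt0)) AK.
    rewrite -mulmxA (partition_mx_J R Pi_part Pi_unif) -scalemxAr (adjmx_J e_reg) mulmxDl.
    rewrite -!scalemxAl (partition_mx_J R Pi_part Pi_unif) mulJJ !mxE !mulr1 => <-.
    by rewrite mulrC.
  apply: trmx_inj; rewrite trmx_mul tr_adjmx linearZ /= tr_partition_idem.
  rewrite /partition_idem mulmxBr -!scalemxAr AK (adjmx_J e_reg).
  rewrite scalerDr scalerBr !scalerA -addrA -scalerBl mulrC.
  congr (_ + _); rewrite -scaleNr; congr (_ *: _).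
  have -> : k%:R = (lambda * s%:R + b%:R * #|T|%:R) / s%:R by rewrite -ks mulfK.
  by field; rewrite s0 v0.
(* The rank of an idempotent is its trace, here [#|Pi| - 1]. *)
apply/eqP; rewrite -(eqr_nat R) -idempotent_trace ?partition_idemK //.
by rewrite trace_partition_idem // card_Pi -natr1 addrK.
Qed.

End Spectrum.
End Graph.

Theorem theorem1p2 (R : realType) (T : finType) (e : rel T) (v m : nat)
    (lambda : R)
    (e_simple : simple_graph e) (e_conn : connected_graph e)
    (e_reg : regular_graph e) (v_def : v = #|T|)
    (lambda_eig : eigenvalue (adjmx e R) lambda)
    (m_def : m = multiplicity (adjmx e R) lambda) :
  let E := spectral_idempotent (adjmx e R) lambda in
  (has_dim (hadamard_span E) 2 <->
     exists Pi : {set {set T}}, full_indubitable e lambda Pi) /\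
  (has_dim (hadamard_span E) 2 ->
     exists (hv : (m.+1 * (v %/ m.+1))%N = #|T|) (K : 'M[R]_#|T|),
       E = (m.+1%:R / v%:R) *: K - v%:R^-1 *: J_mx R #|T| /\
       perm_similar K
         (castmx (hv, hv) ((1%:M : 'M[R]_m.+1) *t J_mx R (v %/ m.+1)))).
Proof.
move=> E; have [k e_k] := e_reg.
have m_gt0 : (0 < m)%N.
  by rewrite m_def lt0n /multiplicity mxrank_eq0.
have T_gt0 : (0 < #|T|)%N.
  by rewrite (leq_trans m_gt0) // m_def rank_leq_row.
have dim2 := spectral_dim2_partition e_simple e_conn e_k T_gt0.
split; first split.
- move=> /dim2[Pi [s [Pi_part Pi_unif s_gt0 defE card_Pi]]]; exists Pi.
  apply: (partition_idem_indubitable e_simple e_k Pi_part Pi_unif s_gt0 defE card_Pi).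
  by rewrite -m_def.
- case=> Pi /(full_indubitable_idem e_simple e_conn e_k T_gt0).
  case=> s [Pi_part Pi_unif s_gt0 Pi_gt1 defE].
  by rewrite /E defE; exact: partition_idem_dim2.
move=> /dim2[Pi [s [Pi_part Pi_unif s_gt0 defE]]]; rewrite -m_def => card_Pi.
have cardT : v = (m.+1 * s)%N.
  by rewrite v_def (card_unif_partition Pi_part Pi_unif) card_Pi.
(* The division is exact: the [m + 1] cells all have size [s]. *)
have sE : (v %/ m.+1)%N = s by rewrite cardT mulKn.
rewrite sE; have hv : (m.+1 * s)%N = #|T| by rewrite -cardT.
exists hv, (partition_mx R Pi); split; last exact: perm_similar_partition_mx.
rewrite /E defE /partition_idem; congr (_ *: _ - _ *: _); last by rewrite v_def.
by rewrite cardT natrM invfM mulrA mulfV ?mul1r // pnatr_eq0.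
Qed.
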